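(* If $k\to\infty$ and $\frac{n}{k+1}\to\infty$ (with $n,k$ ranging over integers), then \[ M(n,k)\sim\frac{n}{k+1}\log\log(k+1); \] that is, for any sequences of integers $(n_i)$, $(k_i)$ with $n_i-1\ge k_i>1$, $k_i\to\infty$ and $\frac{n_i}{k_i+1}\to\infty$, the ratio $M(n_i,k_i)\big/\bigl(\frac{n_i}{k_i+1}\log\log(k_i+1)\bigr)$ tends to $1$.
   Context: All graphs are finite, simple and undirected; all logarithms are natural. For a connected graph $G$, a set $D\subseteq V(G)$ is a dominating set if every vertex of $V(G)\setminus D$ has a neighbor in $D$; it is a connected dominating set if moreover the induced subgraph $G[D]$ is connected. The domination number $\gamma(G)$ (respectively the connected domination number $\gamma_c(G)$) is the minimum cardinality of a dominating set (respectively connected dominating set) of $G$. For integers $n,k$ with $n-1\ge k>1$, $M(n,k)$ denotes the maximum of $\gamma_c(G)-\gamma(G)$ over all connected graphs $G$ with $n$ vertices and minimum degree at least $k$. *)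

(* Defs.v *)
From mathcomp Require Import all_boot.

Set Implicit Arguments.
Unset Strict Implicit.
Unset Printing Implicit Defensive.

Section Graphs.
Variable T : finType.
Implicit Types (e : rel T) (D : {set T}).

Definition simple_graph e : bool :=
  [forall x, ~~ e x x] && [forall x, forall y, e x y == e y x].

(* Connectedness of the subgraph induced on D.  The empty set is connected
   here; this is harmless, as only nonempty D arise (a dominating set of a
   nonempty graph is nonempty). *)
Definition connected_in e D : bool :=
  [forall x in D, forall y in D,
     connect [rel u v | [&& u \in D, v \in D & e u v]] x y].

Definition connected_graph e : bool := [forall x, forall y, connect e x y].

Definition degree e (x : T) : nat := #|[set y | e x y]|.

Definition min_degree_geq e (k : nat) : bool := [forall x, k <= degree e x].

Definition dominating e D : bool :=
  [forall x in ~: D, exists y in D, e x y].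

Definition connected_dominating e D : bool :=
  dominating e D && connected_in e D.

Definition domination_number e : nat :=
  #|[arg min_(D < [set: T] | dominating e D) #|D|]|.

(* If e is connected, [set: T] is a connected dominating set, so that the
   minimum is attained; for other e the value is irrelevant. *)
Definition connected_domination_number e : nat :=
  #|[arg min_(D < [set: T] | connected_dominating e D) #|D|]|.

End Graphs.

Definition adj (T : finType) (E : {set T * T}) : rel T :=
  fun x y => (x, y) \in E.

(* Every graph with n vertices is isomorphic to one on 'I_n, given by its set
   of adjacent ordered pairs.  The truncated subtraction is the true one, since
   the domination number is at most the connected domination number for
   connected graphs; and if k <= n - 1 then the complete graph is in the range
   of the maximum. *)
Definition M (n k : nat) : nat :=
  \max_(E : {set 'I_n * 'I_n} | [&& simple_graph (adj E),
                                    connected_graph (adj E)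
                                  & min_degree_geq (adj E) k])
     (connected_domination_number (adj E) - domination_number (adj E)).

(* Main.v *)
Require Import Defs.
From mathcomp Require Import all_boot all_order all_algebra.
From mathcomp Require Import zify ring lra.

(** Write K = k + 1, a = n / K and b = log (log K).  The proof gives
    [M n k <= a b + 4 a + 1] ([M_upper]), and, for each integer q >= 4, a lower
    bound of the shape [(a / q - 1) * ((q - 4) * (b - C) - 1)] with C depending
    only on q, valid when b is large and a >= q ([M_lower_log]).  As a and b tend
    to infinity, the first is a b (1 + o(1)) and the second (1 - 4/q) a b (1 + o(1)),
    where q is arbitrary.

    Upper bound.  Greedily choosing the vertex that dominates most
    undominated vertices multiplies their number by at most 1 - 1/a, as closed
    neighbourhoods have at least K elements; a log K steps leave at most a
    vertices, so the domination number is at most a log K + a + 1.  Start from a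
    minimum dominating set and treat its elements as clusters to be connected.
    A cluster has at least K vertices in or next to it, so that some
    vertex touches at least a fraction 1/a of the p clusters, and adding this
    vertex merges these into one.  Hence p - a is multiplied by at most 1 - 1/a
    in each step, and a b steps divide it by log K: they bring p from
    about a log K down to about 2 a.  As long as there are several clusters,
    two of them are at distance at most three, and two vertices merge them, so
    the remaining clusters cost only 4 a ([connected_domination_greedy], [gap_le]).

    Lower bound.  The hub graph consists of N gadgets of about L K vertices each.
    In a gadget, Q = L m types are represented by blocks of about k / m equivalent
    vertices.  There are h hubs, each adjacent to m of the types; together they
    dominate the gadget outside the blocks.  Each hub has one guard for every
    m-set of types, adjacent to the hub and to this m-set.  A dominating set that omits
    a hub must contain or otherwise dominate all its guards, and so spends at
    least Q - m + 1 vertices on blocks and guards, more than h + t.  Once the hubs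
    are there, each needs a neighbour in the connected dominating set, and these
    neighbours yield a hitting set for the family of type sets of the hubs.
    If this family has no hitting set of t elements, a connected dominating
    set has at least h + t + 1 vertices in every gadget ([gadget_lower]), while
    the domination number is at most N h + 1, since the union of all blocks is a
    clique.

    It remains to find h <= m sets of types that no t = (L - 3) log m types can
    hit.  The same greedy principle does it ([small_unhittable_family]): a random
    m-set avoids t given types with probability at least exp (- t / (L - 2)),
    which is m ^ (- (1 - 1 / (L - 2))), so that t (log Q) m ^ (1 - 1 / (L - 2)) < m
    sets suffice, for large m, to defeat each of the Q ^ t choices of t types.  The
    number of guards is at most h 2 ^ Q, which is negligible in comparison with K
    if m is a small multiple of log K.  Then log m is b up to a constant, and
    the N = n / (L K) gadgets contribute N t, about (1 - 3 / L) a b, to the gap. *)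

Set Implicit Arguments.
Unset Strict Implicit.
Unset Printing Implicit Defensive.

Import Order.TTheory GRing.Theory Num.Theory.

(** * Dominating sets, induced connectivity and merging of clusters *)

Lemma cardsU1_le (U : finType) (x : U) (S : {set U}) : #|x |: S| <= #|S|.+1.
Proof. by rewrite cardsU1 -add1n leq_add2r leq_b1. Qed.

Section GraphBasics.
Variable T : finType.
Implicit Types (e : rel T) (A B D : {set T}) (P : {set {set T}}).

Lemma simple_graphP e :
  reflect (irreflexive e /\ symmetric e) (simple_graph e).
Proof.
apply: (iffP andP) => [[/forallP irr /forallP sym]|[irr sym]]; split.
- by move=> x; apply/negbTE/irr.
- by move=> x y; move/forallP: (sym x) => /(_ y)/eqP.
- by apply/forallP => x; rewrite irr.
- by apply/forallP => x; apply/forallP => y; rewrite sym.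
Qed.

Lemma dominatingP e D :
  reflect (forall x, x \notin D -> exists2 y, y \in D & e x y) (dominating e D).
Proof.
apply: (iffP forallP) => [dom x xD|dom x].
  by move: (dom x); rewrite inE xD => /exists_inP[y yD exy]; exists y.
by rewrite inE; apply/implyP => /dom[y yD exy]; apply/exists_inP; exists y.
Qed.

Lemma connected_inP e D :
  reflect {in D &, forall x y,
             connect [rel u v | [&& u \in D, v \in D & e u v]] x y}
          (connected_in e D).
Proof.
apply: (iffP forall_inP) => [con x y xD yD|con x xD].
  by move/forall_inP: (con x xD) => /(_ y yD).
by apply/forall_inP => y yD; apply: con.
Qed.

Lemma dominatingT e : dominating e [set: T].
Proof. by apply/dominatingP => x; rewrite inE. Qed.

Lemma domination_number_le e D :
  dominating e D -> domination_number e <= #|D|.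
Proof.
rewrite /domination_number; case: arg_minnP; first exact: dominatingT.
by move=> A _ Amin; apply: Amin.
Qed.

Lemma domination_number_attained e :
  exists2 D, dominating e D & #|D| = domination_number e.
Proof.
rewrite /domination_number; case: arg_minnP; first exact: dominatingT.
by move=> A domA _; exists A.
Qed.

Lemma connected_dominatingT e :
  connected_graph e -> connected_dominating e [set: T].
Proof.
move=> con; rewrite /connected_dominating dominatingT; apply/connected_inP.
move=> x y _ _; move/forallP: con => /(_ x)/forallP/(_ y).
by rewrite (@eq_connect _ _ e) // => u v; rewrite /= !inE.
Qed.

Lemma connected_domination_number_le e D : connected_graph e ->
  connected_dominating e D -> connected_domination_number e <= #|D|.
Proof.
move=> con; rewrite /connected_domination_number.
case: arg_minnP; first exact: connected_dominatingT.
by move=> A _ Amin; apply: Amin.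
Qed.

Lemma connected_domination_number_attained e : connected_graph e ->
  exists2 D, connected_dominating e D & #|D| = connected_domination_number e.
Proof.
move=> con; rewrite /connected_domination_number.
case: arg_minnP; first exact: connected_dominatingT.
by move=> A domA _; exists A.
Qed.

Lemma connect_in_sub e A B x y : A \subset B ->
  connect [rel u v | [&& u \in A, v \in A & e u v]] x y ->
  connect [rel u v | [&& u \in B, v \in B & e u v]] x y.
Proof.
move=> /subsetP sAB; apply: connect_sub => u v /and3P[uA vA euv].
by apply: connect1; rewrite /= !sAB.
Qed.

Lemma connect_in_sym e A : symmetric e ->
  connect_sym [rel u v | [&& u \in A, v \in A & e u v]].
Proof.
by move=> sym; apply: sym_connect_sym => u v; rewrite /= sym andbCA.
Qed.

Lemma connected_in1 e v : connected_in e [set v].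
Proof. by apply/connected_inP => x y /set1P-> /set1P->; apply: connect0. Qed.

Lemma connected_in_root e A x : symmetric e ->
  {in A, forall y, connect [rel u v | [&& u \in A, v \in A & e u v]] x y} ->
  connected_in e A.
Proof.
move=> sym con; apply/connected_inP => y z yA zA.
apply: (@connect_trans _ _ x); last exact: con.
by rewrite connect_in_sym //; apply: con.
Qed.

Lemma connected_inU e A B x y : symmetric e ->
    connected_in e A -> connected_in e B ->
    x \in A -> y \in B -> (x == y) || e x y ->
  connected_in e (A :|: B).
Proof.
move=> sym /connected_inP conA /connected_inP conB xA yB xy.
apply: (@connected_in_root _ _ x) => // z; rewrite inE => /orP[zA|zB].
  by apply: connect_in_sub (conA x z xA zA); apply: subsetUl.
apply: (@connect_trans _ _ y).
  case/orP: xy => [/eqP->//|exy]; apply: connect1.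
  by rewrite /= !inE xA yB exy orbT.
by apply: connect_in_sub (conB y z yB zB); apply: subsetUr.
Qed.

(** A generalization of the set of components of the subgraph induced on the
    union: only the number of clusters is tracked, so a cluster may be any
    nonempty connected piece. *)
Definition clusters e P := {in P, forall C, (C != set0) /\ connected_in e C}.

Definition touches e v (C : {set T}) := [exists u in C, (v == u) || e v u].

Lemma connected_in_star e P v : symmetric e ->
    {in P, forall C, touches e v C /\ connected_in e C} ->
  connected_in e (v |: cover P).
Proof.
move=> sym clP; apply: (@connected_in_root _ _ v) => // y.
rewrite !inE => /orP[/eqP->//|/bigcupP[C CP yC]].
have [/exists_inP[u uC vu] conC] := clP C CP.
have sub : [set v] :|: C \subset v |: cover P.
  by apply/setUS/bigcup_sup.
apply: connect_in_sub sub _.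
move/connected_inP: (connected_inU sym (connected_in1 e v) conC (set11 v) uC vu).
by apply; rewrite !inE ?eqxx ?yC ?orbT.
Qed.

(** The new vertex joins all clusters in its closed neighbourhood into a single
    one; the bound is additive to avoid truncated subtraction. *)
Lemma merge_step e P v : symmetric e -> clusters e P ->
  exists P', [/\ clusters e P', cover P' = v |: cover P &
    #|P'| + #|[set C in P | touches e v C]| <= #|P|.+1].
Proof.
move=> sym clP; set Pv := [set C in P | _].
exists ((v |: cover Pv) |: (P :\: Pv)); split.
- move=> C; rewrite in_setU1 => /orP[/eqP->|]; last first.
    by rewrite inE => /andP[_ /clP].
  split; first by apply/set0Pn; exists v; rewrite !inE eqxx.
  apply: connected_in_star => // C'; rewrite inE => /andP[C'P tC'].
  by split=> //; have [] := clP C' C'P.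
- rewrite /cover bigcup_setU big_set1 -setUA; congr (_ :|: _).
  rewrite -bigcup_setU setDE setUIr setUCr setIT.
  by have /setUidPr -> : Pv \subset P by apply/subsetP => C; rewrite inE => /andP[].
- have Psub : Pv \subset P by apply/subsetP => C; rewrite inE => /andP[].
  rewrite cardsU1 -addnA cardsD (setIidPr Psub) subnK ?subset_leq_card //.
  by rewrite -add1n leq_add2r; case: (_ \notin _).
Qed.

Lemma crossing_edge e A B : symmetric e -> connected_graph e ->
    A != set0 -> B != set0 -> A :|: B = [set: T] ->
  exists x y, [/\ x \in A, y \in B & (x == y) || e x y].
Proof.
move=> sym con /set0Pn[a aA] /set0Pn[b bB] AB.
case: (boolP [exists x in A, exists y in B, (x == y) || e x y]).
  by move=> /exists_inP[x xA /exists_inP[y yB xy]]; exists x, y.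
rewrite negb_exists_in => /forall_inP noE.
have noe x y : x \in A -> y \in B -> ~~ ((x == y) || e x y).
  move=> xA yB; have := noE x xA.
  by rewrite negb_exists_in => /forall_inP/(_ y yB).
have inB x : x \notin A -> x \in B.
  by move=> xA; have := in_setT x; rewrite -AB inE (negbTE xA).
have clA : closed e (mem A).
  apply: intro_closed; first exact: sym_connect_sym.
  move=> x y exy xA; apply/negPn/negP => /inB yB.
  by have := noe x y xA yB; rewrite exy orbT.
have cab : connect e a b by move/forallP: con => /(_ a)/forallP/(_ b).
have := closed_connect clA cab; rewrite /= aA => /esym bA.
by have := noe b b bA bB; rewrite eqxx.
Qed.

(** Every vertex touches some cluster, since the union dominates.  Hence the
    closed neighbourhood of one cluster and that of the union of the others
    cover the connected graph, and so meet or are joined by an edge; its two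
    ends connect two clusters. *)
Lemma merge_pair e P : symmetric e -> connected_graph e ->
    clusters e P -> dominating e (cover P) -> 1 < #|P| ->
  exists P', [/\ clusters e P', dominating e (cover P'),
    #|cover P'| <= #|cover P| + 2 & #|P'| < #|P|].
Proof.
move=> sym con clP /dominatingP dom /card_gt1P[C0 [C1 [C0P C1P C01]]].
pose A := [set x | touches e x C0].
pose B := [set x | [exists C in P :\ C0, touches e x C]].
have touch (C : {set T}) x : x \in C -> touches e x C.
  by move=> xC; apply/exists_inP; exists x; rewrite ?eqxx.
have A0 : A != set0.
  by have [/set0Pn[x xC] _] := clP C0 C0P; apply/set0Pn; exists x; rewrite inE touch.
have B0 : B != set0.
  have [/set0Pn[x xC] _] := clP C1 C1P; apply/set0Pn; exists x; rewrite inE.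
  by apply/exists_inP; exists C1; rewrite ?touch // !inE eq_sym C01.
have AB : A :|: B = [set: T].
  apply/setP => x; rewrite in_setT.
  have [C CP tC] : exists2 C, C \in P & touches e x C.
    case: (boolP (x \in cover P)) => [/bigcupP[C CP xC]|/dom[y /bigcupP[C CP yC] exy]].
      by exists C; rewrite ?touch.
    by exists C => //; apply/exists_inP; exists y; rewrite ?exy ?orbT.
  rewrite !inE; case: (eqVneq C C0) => [<-|CC0]; first by rewrite tC.
  by apply/orP; right; apply/exists_inP; exists C; rewrite // !inE CC0.
have [v [w [vA wB vw]]] := crossing_edge sym con A0 B0 AB.
move: vA wB; rewrite !inE => /exists_inP[u uC0 vu] /exists_inP[C].
rewrite !inE => /andP[CC0 CP] /exists_inP[u' u'C wu'].
have CP0 : C \in P :\ C0 by rewrite !inE CC0.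
have [_ conC0] := clP C0 C0P; have [_ conC] := clP C CP.
have con1 := connected_inU sym (connected_in1 e v) conC0 (set11 v) uC0 vu.
have con2 := connected_inU sym (connected_in1 e w) conC (set11 w) u'C wu'.
have con12 : connected_in e ((v |: C0) :|: (w |: C)).
  by apply: (connected_inU sym con1 con2) vw; rewrite !inE eqxx.
exists (((v |: C0) :|: (w |: C)) |: (P :\ C0 :\ C)).
have cov : cover (((v |: C0) :|: (w |: C)) |: (P :\ C0 :\ C)) = v |: (w |: cover P).
  rewrite /cover bigcup_setU big_set1 (big_setD1 _ C0P) (big_setD1 _ CP0) /=.
  by rewrite -!setUA; congr (_ :|: _); rewrite setUCA.
split.
- move=> E; rewrite in_setU1 => /orP[/eqP->|]; last first.
    by rewrite !inE => /and3P[_ _ /clP].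
  by split=> //; apply/set0Pn; exists v; rewrite !inE eqxx.
- apply/dominatingP => x; rewrite cov !inE !negb_or => /and3P[_ _ /dom[y yP exy]].
  by exists y; rewrite // !inE yP !orbT.
- by rewrite cov addn2 (leq_trans (cardsU1_le _ _)) // ltnS cardsU1_le.
- by rewrite (cardsD1 C0 P) C0P (cardsD1 C (P :\ C0)) CP0 ltnS cardsU1_le.
Qed.

Lemma merge_all e P : symmetric e -> connected_graph e ->
    clusters e P -> dominating e (cover P) ->
  exists2 D, connected_dominating e D & #|D| <= #|cover P| + 2 * #|P|.-1.
Proof.
move=> sym con; have [m] := ubnP #|P|; elim: m P => // m IH P.
rewrite ltnS => Pm clP dom; case: (leqP #|P| 1) => P1; last first.
  have [P' [clP' dom' cov' card']] := merge_pair sym con clP dom P1.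
  have [D cD leD] := IH P' (leq_trans card' Pm) clP' dom'.
  exists D => //; apply: (leq_trans leD).
  by move: cov' card' P1; clear; move: #|P| #|P'| => [|p] [|p'] /=; lia.
exists (cover P); last exact: leq_addr.
rewrite /connected_dominating dom; case: (leqP #|P| 0) => P0.
  have -> : P = set0 by apply/eqP; rewrite -cards_eq0 -leqn0.
  by rewrite /cover big_set0; apply/connected_inP => x y; rewrite inE.
have /cards1P[C PC] : #|P| == 1 by rewrite eqn_leq P1 P0.
rewrite PC /cover big_set1; have := clP C; rewrite PC inE eqxx.
by case.
Qed.

End GraphBasics.

(** * The greedy principle and the two greedy dominations *)

(** Double counting: the average over v of the number of elements of A that v is
    related to is at least #|A| * d / #|T|. *)
Lemma exists_popular (T U : finType) (r : T -> U -> bool) (A : {set U}) (d : nat) :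
    0 < #|T| -> {in A, forall u, d <= #|[set v | r v u]|} ->
  exists v, #|A| * d <= #|T| * #|[set u in A | r v u]|.
Proof.
move=> /card_gt0P[v0 _] degA.
pose g v := #|[set u in A | r v u]|.
case: (@arg_maxnP _ v0 predT g) => // v _ vmax; exists v.
have -> : #|T| * #|[set u in A | r v u]| = \sum_(w : T) g v by rewrite sum_nat_const.
apply: (@leq_trans (\sum_w g w)); last by apply: leq_sum => w _; apply: vmax.
rewrite -sum_nat_const /g.
under [X in _ <= X]eq_bigr => w _ do rewrite -sum1dep_card big_mkcondr /=.
rewrite exchange_big /=; apply: leq_sum => u uA.
by apply: leq_trans (degA u uA) _; rewrite -big_mkcond sum1dep_card.
Qed.

Section GreedyIteration.
Local Open Scope ring_scope.

(** The three greedy arguments below (domination, connection, avoidance of hitting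
    sets) differ in what a state is; each step costs one unit and contracts a
    potential; the number of clusters minus a, one of these, may be negative. *)
Lemma greedy_iteration (R : realFieldType) (S : Type) (inv : S -> Prop)
    (cost : S -> nat) (f : S -> R) (q : R) : 0 <= q ->
    (forall s, inv s ->
       exists s', [/\ inv s', (cost s' <= (cost s).+1)%N & f s' <= q * f s]) ->
  forall j s, inv s ->
    exists s', [/\ inv s', (cost s' <= cost s + j)%N & f s' <= q ^+ j * f s].
Proof.
move=> q0 step; elim=> [|j IH] s invs.
  by exists s; rewrite addn0 expr0 mul1r.
have [s1 [inv1 cost1 f1]] := IH s invs.
have [s2 [inv2 cost2 f2]] := step s1 inv1.
exists s2; split=> //; first by apply: leq_trans cost2 _; rewrite addnS ltnS.
by apply: le_trans f2 _; rewrite exprS -mulrA; apply: ler_wpM2l.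
Qed.

End GreedyIteration.

Section UpperBound.
Local Open Scope ring_scope.
Variables (R : realFieldType) (T : finType) (e : rel T) (k : nat).
Hypothesis e_simple : simple_graph e.
Hypothesis e_degree : min_degree_geq e k.
Hypothesis T_gt0 : (0 < #|T|)%N.

Let a : R := #|T|%:R / k.+1%:R.

Lemma closed_neighborhood_card x :
  (k.+1 <= #|[set y | (x == y) || e x y]|)%N.
Proof.
have [irr sym] := simple_graphP _ e_simple.
have -> : [set y | (x == y) || e x y] = x |: [set y | e x y].
  by apply/setP => y; rewrite !inE eq_sym.
rewrite cardsU1 inE irr add1n ltnS.
by move/forallP: e_degree => /(_ x).
Qed.

Lemma ratio_gt0 : 0 < a.
Proof. by rewrite divr_gt0 ?ltr0n. Qed.

Lemma ratio_ge1 : 1 <= a.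
Proof.
rewrite ler_pdivlMr ?ltr0n // mul1r ler_nat.
have [x _] := card_gt0P T_gt0.
by apply: leq_trans (closed_neighborhood_card x) _; apply: max_card.
Qed.

Lemma contraction_ge0 : 0 <= 1 - a^-1.
Proof. by rewrite subr_ge0 invf_le1 ?ratio_gt0 ?ratio_ge1. Qed.

Lemma popular_real (x y : nat) :
  (x * k.+1 <= #|T| * y)%N -> x%:R <= a * y%:R.
Proof.
move=> xy; rewrite /a mulrAC ler_pdivlMr ?ltr0n // -!natrM ler_nat //.
Qed.

Lemma domination_number_greedy (j : nat) :
  (domination_number e)%:R <= j%:R + (1 - a^-1) ^+ j * #|T|%:R.
Proof.
have [irr sym] := simple_graphP _ e_simple.
pose undom (D : {set T}) := [set x | [forall y in D, ~~ ((x == y) || e x y)]].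
have step (D : {set T}) : True -> exists D' : {set T},
    [/\ True, (#|D'| <= #|D|.+1)%N & #|undom D'|%:R <= (1 - a^-1) * #|undom D|%:R].
  move=> _; pose r v x := (x == v) || e x v.
  have [||v hv] := @exists_popular T T r (undom D) k.+1 => //.
    by move=> x _; apply: closed_neighborhood_card.
  exists (v |: D); split; rewrite ?cardsU1_le //.
  have sub : undom (v |: D) \subset undom D :\: [set x in undom D | r v x].
    apply/subsetP => x; rewrite !inE => /forall_inP ux.
    have uD : [forall y in D, ~~ ((x == y) || e x y)].
      by apply/forall_inP => y yD; apply: ux; rewrite !inE yD orbT.
    by rewrite uD /= andbT /r; apply: ux; rewrite !inE eqxx.
  have := subset_leq_card sub; rewrite cardsDS; last first.
    by apply/subsetP => x; rewrite inE => /andP[].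
  move=> le1; have := popular_real hv; set c := #|[set _ in _ | _]| in hv le1 * => le2.
  have cle : (c <= #|undom D|)%N by apply/subset_leq_card/subsetP => x; rewrite inE => /andP[].
  have : #|undom (v |: D)|%:R <= #|undom D|%:R - c%:R :> R.
    by rewrite -natrB // ler_nat.
  have : #|undom D|%:R / a <= c%:R by rewrite ler_pdivrMr ?ratio_gt0 // mulrC.
  lra.
(* The vertices still undominated after j steps are added to the set. *)
have [D [_ cD fD]] := greedy_iteration contraction_ge0 step j (s := set0) I.
have dom : dominating e (D :|: undom D).
  apply/dominatingP => x; rewrite !inE negb_or => /andP[xD].
  rewrite negb_forall_in => /exists_inP[y yD]; rewrite negbK.
  case/orP => [/eqP xy|exy]; first by rewrite xy yD in xD.
  by exists y; rewrite // inE yD.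
have le1 := leq_trans (domination_number_le dom) (leq_card_setU _ _).
rewrite cards0 add0n in cD.
have le2 : (domination_number e <= j + #|undom D|)%N.
  by apply: leq_trans le1 _; rewrite leq_add2r.
apply: (@le_trans _ _ (j + #|undom D|)%:R); first by rewrite ler_nat.
rewrite natrD lerD2l (le_trans fD) // ler_wpM2l ?exprn_ge0 ?contraction_ge0 //.
by rewrite ler_nat max_card.
Qed.

(** The potential is the number of clusters minus a: replacing c >= p / a of p
    clusters by one turns p - a into at most p - p / a + 1 - a, which is
    (1 - 1/a) * (p - a).  The p clusters left after j steps are merged in pairs. *)
Lemma connected_domination_greedy (j : nat) : connected_graph e ->
  exists p : nat, p%:R - a <= (1 - a^-1) ^+ j * ((domination_number e)%:R - a)
    /\ (connected_domination_number e <= domination_number e + j + 2 * p.-1)%N.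
Proof.
move=> con; have [irr sym] := simple_graphP _ e_simple.
have [D0 dom0 cD0] := domination_number_attained e.
pose inv P := clusters e P /\ dominating e (cover P).
have step P : inv P -> exists P', [/\ inv P', (#|cover P'| <= #|cover P|.+1)%N &
    #|P'|%:R - a <= (1 - a^-1) * (#|P|%:R - a)].
  move=> [clP domP].
  have [||v hv] := @exists_popular T {set T} (touches e) P k.+1 => //.
    move=> C /clP[/set0Pn[x xC] _].
    apply: leq_trans (closed_neighborhood_card x) _.
    apply/subset_leq_card/subsetP => v; rewrite !inE => xv.
    by apply/exists_inP; exists x; rewrite // eq_sym sym.
  have [P' [clP' covP' card']] := merge_step v sym clP.
  exists P'; split; rewrite ?covP' ?cardsU1_le //.
    split=> //; rewrite covP'; apply/dominatingP => x.
    rewrite !inE negb_or => /andP[_] /(dominatingP _ _ domP)[y yP exy].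
    by exists y; rewrite // !inE yP orbT.
  have := popular_real hv; set c := #|[set _ in _ | _]| in card' * => le2.
  have : #|P'|%:R + c%:R <= #|P|%:R + 1 :> R by rewrite -natrD natr1 ler_nat.
  have : #|P|%:R / a <= c%:R by rewrite ler_pdivrMr ?ratio_gt0 // mulrC.
  have : a^-1 * a = 1 by rewrite mulVf // gt_eqF // ratio_gt0.
  lra.
pose P0 := [set [set x] | x in D0].
have cov0 : cover P0 = D0.
  rewrite cover_imset; apply/setP => x; apply/bigcupP/idP => [[y yD /set1P->]//|xD].
  by exists x; rewrite ?inE.
have inv0 : inv P0.
  split; last by rewrite cov0.
  move=> C /imsetP[x _ ->]; rewrite connected_in1; split=> //.
  by apply/set0Pn; exists x; rewrite inE.
have [P [[clP domP] cP fP]] := greedy_iteration contraction_ge0 step j inv0.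
exists #|P|; split.
  by rewrite /P0 card_imset ?cD0 // in fP; apply: set1_inj.
have [D cD leD] := merge_all sym con clP domP.
apply: leq_trans (connected_domination_number_le con cD) _.
by apply: leq_trans leD _; rewrite leq_add2r -cD0 -cov0.
Qed.

End UpperBound.

(** * Invariance under relabelling of the vertices *)

Section Transport.
Variables (T U : finType) (f : T -> U) (g : U -> T) (e' : rel T) (e : rel U).
Hypotheses (fK : cancel f g) (gK : cancel g f).
Hypothesis e'E : forall x y, e' x y = e (f x) (f y).

Lemma homo_connect (S S' : finType) (h : S -> S') (r : rel S) (r' : rel S') :
  {homo h : x y / r x y >-> r' x y} ->
  {homo h : x y / connect r x y >-> connect r' x y}.
Proof.
move=> hr x y /connectP[p]; elim: p x => [x _ -> //|z p IH x] /=.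
by case/andP=> /hr/connect1 cxz pz lastp; apply: connect_trans cxz (IH _ pz lastp).
Qed.

Lemma domination_number_transport :
  domination_number e' <= domination_number e.
Proof.
have [D /dominatingP dom <-] := domination_number_attained e.
have -> : #|D| = #|f @^-1: D| by rewrite on_card_preimset //; exists g => x _.
apply: domination_number_le; apply/dominatingP => x; rewrite inE => /dom[y yD exy].
by exists (g y); rewrite ?e'E ?inE gK.
Qed.

Lemma connected_graph_transport :
  connected_graph e -> connected_graph e'.
Proof.
move=> con; apply/forallP => x; apply/forallP => y.
rewrite -(fK x) -(fK y); apply: (@homo_connect _ _ g e).
  by move=> u v euv; rewrite e'E !gK.
by move/forallP: con => /(_ (f x))/forallP/(_ (f y)).
Qed.

Lemma connected_domination_number_transport : connected_graph e ->
  connected_domination_number e <= connected_domination_number e'.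
Proof.
move=> con.
have [D /andP[/dominatingP dom /connected_inP conD] <-] :=
  connected_domination_number_attained (connected_graph_transport con).
rewrite -(card_imset (mem D) (can_inj fK)); apply: connected_domination_number_le => //.
apply/andP; split.
  apply/dominatingP => x xD; have [|y yD exy] := dom (g x).
    by apply: contra xD => gxD; apply/imsetP; exists (g x).
  by exists (f y); rewrite ?imset_f //; move: exy; rewrite e'E gK.
apply/connected_inP => x y /imsetP[x' x'D ->] /imsetP[y' y'D ->].
apply: homo_connect (conD x' y' x'D y'D) => u v /= /and3P[uD vD euv].
by rewrite -e'E !imset_f.
Qed.

End Transport.

Lemma gap_le_M (V : finType) (e : rel V) (n k : nat) :
    #|V| = n -> simple_graph e -> connected_graph e -> min_degree_geq e k ->
  connected_domination_number e - domination_number e <= M n k.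
Proof.
move=> <- sg con deg; pose f := @enum_val V V; pose g := @enum_rank V.
have fK : cancel f g := @enum_valK V; have gK : cancel g f := @enum_rankK V.
pose E := [set p : 'I_#|V| * 'I_#|V| | e (f p.1) (f p.2)].
have adjE x y : adj E x y = e (f x) (f y) by rewrite /adj inE.
have [irr sym] := simple_graphP _ sg.
apply: (@leq_trans (connected_domination_number (adj E) - domination_number (adj E))).
  rewrite leq_sub //.
    exact: connected_domination_number_transport fK gK adjE con.
  exact: domination_number_transport fK gK adjE.
apply: (@leq_bigmax_cond _ _
  (fun E => connected_domination_number (adj E) - domination_number (adj E))).
apply/and3P; split.
- by apply/simple_graphP; split=> [x|x y]; rewrite !adjE ?irr // sym.
- exact: connected_graph_transport fK gK adjE con.
- apply/forallP => x; apply: leq_trans (forallP deg (f x)) _.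
  rewrite /degree -(@on_card_preimset _ _ f); last by exists g => y _.
  by apply/subset_leq_card/subsetP => y; rewrite !inE adjE.
Qed.

(** * The hub graph *)

Section HubGraph.
Variables (Z I P C D W : finType) (phi : D -> {set P}) (psi : W -> {set P}).

(** Spare vertices (Z), which serve to adjust the order of the graph, and gadgets
    indexed by I.  A gadget consists of the blocks (for each type in P a set of
    twins indexed by C), the hubs (D) and the guards (D * W); phi and psi give the
    types that hubs and guards are adjacent to. *)
Definition hub_vertex := (Z + I * (P * C + (D + D * W)))%type.

Notation block i j c := (inr (i, inl (j, c))).
Notation hub i d := (inr (i, inr (inl d))).
Notation guard i d w := (inr (i, inr (inr (d, w)))).

(** The spare vertices and the blocks of all gadgets, which will form one clique.
    This connects the gadgets, and it leaves the neighbourhoods of hubs and guards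
    inside their own gadget. *)
Definition core (u : hub_vertex) : bool :=
  match u with inl _ => true | inr (_, inl _) => true | _ => false end.

Definition hub_arc (u v : hub_vertex) : bool :=
  match u, v with
  | hub i d, block i' j _ => (i == i') && (j \in phi d)
  | guard i _ w, block i' j _ => (i == i') && (j \in psi w)
  | guard i d _, hub i' d' => (i == i') && (d == d')
  | _, _ => [&& core u, core v & u != v]
  end.

Definition hub_graph : rel hub_vertex := fun u v => hub_arc u v || hub_arc v u.

Variables (k m t : nat) (i0 : I) (c0 : C).
Hypothesis phi_card : forall d, #|phi d| = m.
Hypothesis psi_card : forall w, #|psi w| = m.
Hypothesis m_gt0 : 0 < m.
Hypothesis m_lt : m < #|P|.
Hypothesis k_le : k <= m * #|C|.

Lemma hub_graph_sym : symmetric hub_graph.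
Proof. by move=> u v; rewrite /hub_graph orbC. Qed.

Lemma hub_graph_simple : simple_graph hub_graph.
Proof.
apply/simple_graphP; split; last exact: hub_graph_sym.
move=> u; rewrite /hub_graph orbb.
by case: u => [z|[i [[j c]|[d|[d w]]]]] //=; rewrite eqxx.
Qed.

Lemma hub_graph_core u v : core u -> core v -> u != v -> hub_graph u v.
Proof.
move=> cu cv uv; apply/orP; left; rewrite /hub_arc.
by case: u cu uv => [z|[i [[j c]|[d|[d w]]]]] // _; case: v cv => [z'|[i' [[j' c']|[d'|[d' w']]]]] // _ ->.
Qed.

Lemma block_inj i : injective (fun p : P * C => block i p.1 p.2 : hub_vertex).
Proof. by move=> [j c] [j' c'] /= [-> ->]. Qed.

Lemma degree_blocks (u : hub_vertex) i (J : {set P}) :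
  {in J, forall j c, hub_graph u (block i j c)} -> #|J| * #|C| <= degree hub_graph u.
Proof.
move=> hJ; rewrite -cardsT -cardsX -(card_imset _ (@block_inj i)).
apply/subset_leq_card/subsetP => v /imsetP[[j c]]; rewrite !inE /= andbT => jJ ->.
exact: hJ.
Qed.

Lemma hub_graph_degree : min_degree_geq hub_graph k.
Proof.
have coreP u : core u -> k <= degree hub_graph u.
  move=> cu; rewrite -ltnS.
  apply: (@leq_trans #|[set v | core v]|); last first.
    rewrite (cardsD1 u) inE cu add1n ltnS; apply/subset_leq_card/subsetP => v.
    by rewrite !inE => /andP[vu cv]; apply: hub_graph_core; rewrite // eq_sym.
  apply: (@leq_trans (#|P| * #|C|)); last first.
    rewrite -card_prod -cardsT -(card_imset _ (@block_inj i0)).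
    by apply/subset_leq_card/subsetP => v /imsetP[[j c] _ ->]; rewrite inE.
  have C_gt0 : 0 < #|C| by apply/card_gt0P; exists c0.
  apply: (@leq_trans (m.+1 * #|C|)); last by rewrite leq_mul2r m_lt orbT.
  by rewrite mulSn -add1n leq_add.
apply/forallP => -[z|[i [[j c]|[d|[d w]]]]]; try exact: coreP.
- apply: leq_trans k_le _; rewrite -(phi_card d); apply: (@degree_blocks _ i).
  by move=> j jd c; rewrite /hub_graph /= eqxx jd.
- apply: leq_trans k_le _; rewrite -(psi_card w); apply: (@degree_blocks _ i).
  by move=> j jd c; rewrite /hub_graph /= eqxx jd.
Qed.

Lemma exists_mem_card (S : {set P}) : #|S| = m -> exists j, j \in S.
Proof. by move=> Sm; apply/set0Pn; rewrite -card_gt0 Sm. Qed.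

Lemma hub_graph_connected : connected_graph hub_graph.
Proof.
have [j0 _] : exists j : P, j \in P by apply/card_gt0P; apply: leq_trans m_lt.
pose r : hub_vertex := block i0 j0 c0.
have coreP u : core u -> connect hub_graph u r.
  move=> cu; case: (eqVneq u r) => [->|ur]; first exact: connect0.
  by apply/connect1/hub_graph_core.
have toroot u : connect hub_graph u r.
  case: u => [z|[i [[j c]|[d|[d w]]]]]; try exact: coreP.
  - have [j jd] := exists_mem_card (phi_card d).
    apply: (@connect_trans _ _ (block i j c0)); last exact: coreP.
    by apply: connect1; rewrite /hub_graph /= eqxx jd.
  - have [j jw] := exists_mem_card (psi_card w).
    apply: (@connect_trans _ _ (block i j c0)); last exact: coreP.
    by apply: connect1; rewrite /hub_graph /= eqxx jw.
apply/forallP => u; apply/forallP => v; apply: connect_trans (toroot u) _.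
by rewrite (sym_connect_sym hub_graph_sym).
Qed.

(** The hubs dominate the guards, and one core vertex dominates the core. *)
Lemma hub_graph_domination : domination_number hub_graph <= (#|I| * #|D|).+1.
Proof.
have [j0 _] : exists j : P, j \in P by apply/card_gt0P; apply: leq_trans m_lt.
pose r : hub_vertex := block i0 j0 c0.
pose h (p : I * D) : hub_vertex := hub p.1 p.2.
rewrite -card_prod -cardsT.
apply: leq_trans (domination_number_le (D := r |: h @: setT) _) _; last first.
  by apply: leq_trans (cardsU1_le _ _) _; rewrite ltnS leq_imset_card.
apply/dominatingP => u; rewrite !inE negb_or => /andP[ur uh].
have coreP : core u -> exists2 y, y \in r |: h @: setT & hub_graph u y.
  by move=> cu; exists r; rewrite ?setU11 // hub_graph_core.
case: u coreP ur uh => [z|[i [[j c]|[d|[d w]]]]] coreP ur uh; try exact: coreP.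
  by case/negP: uh; apply/imsetP; exists (i, d).
exists (hub i d); last by rewrite /hub_graph /= !eqxx.
by rewrite in_setU1; apply/orP; right; apply/imsetP; exists (i, d).
Qed.

Hypothesis phi_hitting :
  forall J : {set P}, (forall d, exists2 j, j \in phi d & j \in J) -> t < #|J|.
Hypothesis psi_spread :
  forall J : {set P}, #|D| + t < #|J| + #|[set w | [disjoint psi w & J]]|.

Section Gadget.
Variables (A : {set hub_vertex}) (i : I).
Hypothesis A_dom : dominating hub_graph A.
Hypothesis A_con : connected_in hub_graph A.

Let AY := [set p : P * C | block i p.1 p.2 \in A].
Let AD := [set d : D | hub i d \in A].
Let AX := [set q : D * W | guard i q.1 q.2 \in A].

(** If the hub d is absent, each of its guards either lies in A or has a neighbour
    in a block that meets A. *)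
Lemma gadget_missing_hub d : d \notin AD -> #|D| + t < #|AY| + #|AX|.
Proof.
rewrite inE => dA; pose J := [set p.1 | p in AY].
apply: leq_trans (psi_spread J) _; apply: leq_add; first exact: leq_imset_card.
have inj : injective (fun w : W => (d, w)) by move=> w w' [].
rewrite -(card_imset _ inj); apply/subset_leq_card/subsetP => q /imsetP[w].
rewrite inE => dis ->; rewrite inE /=; apply/negPn/negP => wA.
have [y yA] := dominatingP _ _ A_dom _ wA.
rewrite /hub_graph; case: y yA => [z|[i' [[j c]|[d'|[d' w']]]]] yA //=.
- rewrite orbF => /andP[/eqP ii jw]; rewrite -ii in yA.
  have jJ : j \in J by apply/imsetP; exists (j, c); rewrite // inE.
  by move: dis; rewrite disjoint_sym => /disjointFr - /(_ j jJ); rewrite jw.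
- rewrite orbF => /andP[/eqP ii /eqP dd].
  by move: dA; rewrite ii dd yA.
Qed.

(** A hub does not dominate a block of a type outside its own set, so A has a
    second element, and a path in A leads to it. *)
Lemma hub_not_isolated d : d \in AD -> exists2 v, v \in A & hub_graph (hub i d) v.
Proof.
rewrite inE => dA.
have [j jd] : exists j, j \notin phi d.
  apply/existsP; rewrite -negb_forall; apply/negP => /forallP alld.
  move: m_lt; rewrite -(phi_card d) -cardsT ltnNge subset_leq_card //.
  by apply/subsetP => j _; apply: alld.
have [v vA vd] : exists2 v, v \in A & v != hub i d.
  case: (boolP (block i j c0 \in A)) => [bA|/(dominatingP _ _ A_dom)[y yA ey]].
    by exists (block i j c0) => //; apply/eqP.
  exists y => //; apply/eqP => yd; move: ey; rewrite yd /hub_graph /=.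
  by rewrite eqxx (negbTE jd).
move/connected_inP: A_con => /(_ _ _ dA vA)/connectP[p].
case: p => [_ vd'|v' p /= /andP[/and3P[_ v'A dv'] _] _]; last by exists v'.
by rewrite /= in vd'; rewrite vd' eqxx in vd.
Qed.

(** Each hub has a neighbour in A, of a type that hits its set or a guard.
    Replacing each guard in A by one type adjacent to its hub turns the elements
    of A outside the hubs into a hitting set for phi. *)
Lemma gadget_all_hubs : AD = [set: D] -> t < #|AY| + #|AX|.
Proof.
move=> allD.
pose pick_ground d := xchoose (exists_mem_card (phi_card d)).
pose J := [set p.1 | p in AY] :|: [set pick_ground q.1 | q in AX].
apply: (@leq_trans #|J|); last first.
  by apply: leq_trans (leq_card_setU _ _) _; apply: leq_add; apply: leq_imset_card.
apply: phi_hitting => d.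
have dAD : d \in AD by rewrite allD inE.
have [v vA] := hub_not_isolated dAD.
rewrite /hub_graph; case: v vA => [z|[i' [[j c]|[d'|[d' w']]]]] vA //=.
- rewrite orbF => /andP[/eqP ii jd]; rewrite -ii in vA; exists j => //.
  by rewrite inE; apply/orP; left; apply/imsetP; exists (j, c); rewrite // inE.
- move=> /andP[/eqP ii /eqP dd]; rewrite ii dd in vA.
  exists (pick_ground d).
    exact: xchooseP.
  by rewrite inE; apply/orP; right; apply/imsetP; exists (d, w'); rewrite // inE.
Qed.

(** Omitting a hub has to be paid for at its guards, and keeping all hubs requires
    vertices that connect them. *)
Lemma gadget_lower : #|D| + t < #|AY| + (#|AD| + #|AX|).
Proof.
case: (boolP (AD == setT)) => [/eqP allD|].
  by rewrite addnCA -cardsT -allD ltn_add2l; apply: gadget_all_hubs.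
rewrite eqEsubset subsetT /= => /subsetPn[d _ /gadget_missing_hub lt].
by apply: leq_trans lt _; rewrite leq_add2l leq_addl.
Qed.

End Gadget.

Lemma hub_graph_connected_domination :
  #|I| * (#|D| + t).+1 <= connected_domination_number hub_graph.
Proof.
have [A /andP[domA conA] <-] :=
  connected_domination_number_attained hub_graph_connected.
rewrite -sum_nat_const -sum1_card [leqRHS]big_mkcond /= big_sumType /=.
apply: leq_trans (leq_addl _ _).
apply: (@leq_trans (\sum_i \sum_g (if inr (i, g) \in A then 1 else 0))); last first.
  by rewrite pair_bigA; apply: eq_leq; apply: eq_bigr => -[].
apply: leq_sum => i _; apply: leq_trans (gadget_lower i domA conA) _.
rewrite !big_sumType /= -!big_mkcond /= !sum1dep_card.
rewrite leq_add ?leq_add //; apply/subset_leq_card/subsetP => -[x y]; rewrite !inE //.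
Qed.

Lemma hub_graph_gap :
  #|I| * t <= connected_domination_number hub_graph - domination_number hub_graph.
Proof.
have I0 : 0 < #|I| by apply/card_gt0P; exists i0.
have := hub_graph_domination; have := hub_graph_connected_domination.
by move: I0; rewrite mulnS mulnDr; clear; lia.
Qed.

Lemma hub_vertex_card :
  #|{: hub_vertex}| = #|Z| + #|I| * (#|P| * #|C| + (#|D| + #|D| * #|W|)).
Proof. by rewrite !(card_sum, card_prod). Qed.

End HubGraph.

(** * Small families of sets that are hard to hit *)

Section HittingSets.
Variables (Q m : nat).

Definition msubset := {S : {set 'I_Q} | #|S| == m}.

Lemma card_msubset : #|{: msubset}| = 'C(Q, m).
Proof. by rewrite card_sig -[in RHS](card_ord Q) -card_draws cardsE; apply: eq_card. Qed.

Lemma card_disjoint_msubset (J : {set 'I_Q}) :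
  #|[set w : msubset | [disjoint val w & J]]| = 'C(Q - #|J|, m).
Proof.
have -> : Q - #|J| = #|~: J| by rewrite (cardsCs (~: J)) setCK card_ord.
rewrite -cards_draws -(card_imset _ val_inj).
suff <- : [set val w | w in [set w : msubset | [disjoint val w & J]]] =
          [set S : {set 'I_Q} | S \subset ~: J & #|S| == m] by [].
apply/setP => S; rewrite [RHS]in_set; apply/imsetP/andP => [[w]|[sub cS]].
  by rewrite in_set => dis ->; rewrite (valP w) -disjoints_subset dis.
exists (Sub S cS : msubset) => //.
by rewrite inE /= disjoints_subset.
Qed.

Lemma sub_leq_bin (r : nat) : 0 < m -> r.+1 - m <= 'C(r, m).
Proof.
case: m => // p _; elim: r => [|r IH]; first by rewrite subSS.
rewrite binS; case: (leqP p r) => pr; last by rewrite subSS (eqP pr).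
have := bin_gt0 r p; rewrite pr => C_gt0.
by apply: leq_trans (leq_add IH C_gt0); lia.
Qed.

(** If J leaves out r >= m types, at least r + 1 - m of the m-sets avoid J: each
    further type that is left out costs at least one more guard. *)
Lemma msubset_spread (J : {set 'I_Q}) : 0 < m ->
  Q.+1 - m <= #|J| + #|[set w : msubset | [disjoint val w & J]]|.
Proof.
move=> m_gt0; rewrite card_disjoint_msubset.
have := sub_leq_bin (Q - #|J|) m_gt0; have := max_card (mem J); rewrite card_ord; lia.
Qed.

Local Open Scope ring_scope.

(** Greedy choice of the sets: the potential is the number of maps from 'I_t to
    'I_Q whose range hits all sets chosen so far.  For each such map a fraction
    of at least C(Q - t, m) / C(Q, m) of the m-sets avoids its range, so some m-set
    defeats that fraction of the surviving maps.  Counting maps instead of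
    t-sets makes their initial number Q ^ t, and covers all sets of at most t
    points at once. *)
Lemma small_unhittable_family (R : realFieldType) (t s : nat) :
    (t <= Q)%N -> (m <= Q)%N ->
    (1 - 'C(Q - t, m)%:R / 'C(Q, m)%:R) ^+ s * (Q ^ t)%:R < 1 :> R ->
  exists2 F : {set msubset}, (#|F| <= s)%N &
    forall J : {set 'I_Q},
      (forall w : msubset, w \in F -> exists2 j, j \in val w & j \in J) -> (t < #|J|)%N.
Proof.
move=> tQ mQ small; set q : R := 1 - _ in small.
have C0 : 0 < 'C(Q, m)%:R :> R by rewrite ltr0n bin_gt0.
have q0 : 0 <= q.
  by rewrite subr_ge0 ler_pdivrMr // mul1r ler_nat leq_bin2l // leq_subr.
pose rng (g : {ffun 'I_t -> 'I_Q}) := g @: [set: 'I_t].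
pose hit (F : {set msubset}) :=
  [set g | [forall w in F, ~~ [disjoint val w & rng g]]].
have step (F : {set msubset}) : True -> exists F' : {set msubset}, [/\ True,
    (#|F'| <= #|F|.+1)%N & #|hit F'|%:R <= q * #|hit F|%:R].
  move=> _; pose r (w : msubset) g := [disjoint val w & rng g].
  have [||w hw] := @exists_popular _ _ r (hit F) 'C(Q - t, m).
  - by rewrite card_msubset bin_gt0.
  - move=> g _; rewrite card_disjoint_msubset leq_bin2l // leq_sub2l //.
    by rewrite -[leqRHS](card_ord t) -cardsT leq_imset_card.
  exists (w |: F); split; rewrite ?cardsU1_le //.
  have sub : hit (w |: F) \subset hit F :\: [set g in hit F | r w g].
    apply/subsetP => g; rewrite !inE => /forall_inP hg.
    have hF : [forall w in F, ~~ [disjoint val w & rng g]].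
      by apply/forall_inP => v vF; apply: hg; rewrite !inE vF orbT.
    by rewrite hF andbT /=; apply: hg; rewrite !inE eqxx.
  have := subset_leq_card sub; rewrite cardsDS; last first.
    by apply/subsetP => g; rewrite inE => /andP[].
  move=> le1; move: hw le1; set c := #|[set _ in _ | _]| => hw le1.
  have cle : (c <= #|hit F|)%N.
    by apply/subset_leq_card/subsetP => g; rewrite inE => /andP[].
  have : #|hit (w |: F)|%:R <= #|hit F|%:R - c%:R :> R by rewrite -natrB // ler_nat.
  have : #|hit F|%:R * ('C(Q - t, m)%:R / 'C(Q, m)%:R) <= c%:R :> R.
    by rewrite mulrA ler_pdivrMr // [leRHS]mulrC -!natrM ler_nat -card_msubset.
  rewrite /q; set x := _ / _; lra.
have [F [_ cF fF]] := greedy_iteration q0 step s (s := set0) I.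
rewrite cards0 add0n in cF; exists F => // J hitJ; rewrite ltnNge; apply/negP => Jt.
have hit0 : hit F = set0.
  apply/eqP; rewrite -cards_eq0 -leqn0 -ltnS -(ltr_nat R).
  apply: le_lt_trans fF (le_lt_trans _ small); rewrite ler_wpM2l ?exprn_ge0 //.
  by rewrite ler_nat; apply: leq_trans (max_card _) _; rewrite card_ffun !card_ord.
have [g gJ] : exists g : {ffun 'I_t -> 'I_Q}, J \subset rng g.
  case: (posnP t) => [t0|t_gt0].
    have g0 : 'I_t -> 'I_Q by rewrite t0 => -[].
    exists [ffun x => g0 x]; rewrite (_ : J = set0) ?sub0set //.
    by apply/eqP; rewrite -cards_eq0 -leqn0 -t0.
  pose x0 : 'I_Q := Ordinal (leq_trans t_gt0 tQ).
  exists [ffun i : 'I_t => nth x0 (enum J) i]; apply/subsetP => j jJ.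
  have ij : (index j (enum J) < t)%N.
    by apply: leq_trans Jt; rewrite cardE index_mem mem_enum.
  by apply/imsetP; exists (Ordinal ij); rewrite ?inE // ffunE /= nth_index ?mem_enum.
suff : g \in hit F by rewrite hit0 inE.
rewrite inE; apply/forall_inP => w /hitJ[j jw jJ].
by apply/pred0Pn; exists j; rewrite /= jw; apply: (subsetP gJ).
Qed.

End HittingSets.

(** N gadgets with a family of at most s hubs and all m-sets as guards; what is
    left of the n vertices becomes spare. *)
Lemma M_lower (R : realFieldType) (Q m t s c N n k : nat) :
    0 < m -> s + t + m <= Q -> 0 < c -> k <= m * c -> 0 < N ->
    N * (Q * c + (s + s * 'C(Q, m))) <= n ->
    ((1 - 'C(Q - t, m)%:R / 'C(Q, m)%:R) ^+ s * (Q ^ t)%:R < 1 :> R)%R ->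
  N * t <= M n k.
Proof.
move=> m_gt0 stm c_gt0 kmc N_gt0 Nn small.
have [tQ mQ] : t <= Q /\ m <= Q by lia.
have [F Fs Fhit] := small_unhittable_family tQ mQ small.
pose D := {w : msubset Q m | w \in F}; pose W := msubset Q m.
pose phi (d : D) := val (val d); pose psi (w : W) := val w.
have cardD : #|{: D}| = #|F| by rewrite card_sig; apply: eq_card.
have cardW : #|{: W}| = 'C(Q, m) by apply: card_msubset.
have F_gt0 : 0 < #|F|.
  rewrite lt0n cards_eq0; apply/eqP => F0.
  have : t < #|set0 : {set 'I_Q}| by apply: Fhit => w; rewrite F0 inE.
  by rewrite cards0.
pose i0 : 'I_N := Ordinal N_gt0; pose c0 : 'I_c := Ordinal c_gt0.
pose z := n - N * (Q * c + (#|F| + #|F| * 'C(Q, m))).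
have phi_card d : #|phi d| = m by exact: eqP (valP (val d)).
have psi_card w : #|psi w| = m by exact: eqP (valP w).
have mltQ : m < #|'I_Q| by rewrite card_ord; lia.
have kc : k <= m * #|'I_c| by rewrite card_ord.
have hphi (J : {set 'I_Q}) : (forall d, exists2 j, j \in phi d & j \in J) -> t < #|J|.
  by move=> h; apply: Fhit => w wF; apply: (h (Sub w wF)).
have hpsi (J : {set 'I_Q}) :
    #|{: D}| + t < #|J| + #|[set w | [disjoint psi w & J]]|.
  by rewrite cardD; apply: leq_trans (msubset_spread J m_gt0); lia.
have := hub_graph_gap 'I_z i0 c0 phi_card psi_card m_gt0 mltQ hphi hpsi.
rewrite card_ord => gap; apply: (leq_trans gap); apply: gap_le_M.
- rewrite hub_vertex_card !card_ord cardD cardW /z subnK //.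
  apply: leq_trans Nn; rewrite leq_mul2l leq_add2l; apply/orP; right.
  by apply: leq_add => //; rewrite leq_mul2r Fs orbT.
- exact: hub_graph_simple.
- exact: (hub_graph_connected _ i0 c0 phi_card psi_card m_gt0 mltQ).
- exact: (hub_graph_degree _ i0 c0 phi_card psi_card mltQ kc).
Qed.

(** * Upper bound on the gap *)

From mathcomp Require Import all_classical all_reals all_analysis.
Import numFieldNormedType.Exports.
Local Open Scope ring_scope.

Section Estimates.
Variable R : realType.

Lemma pow_one_sub_le_exp (x : R) (j : nat) :
  0 <= 1 - x -> (1 - x) ^+ j <= expR (- (j%:R * x)).
Proof.
move=> x1; rewrite -mulrN expRM_natl; apply: lerXn2r; rewrite ?nnegrE ?expR_ge0 //.
exact: expR_ge1Dx.
Qed.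

(** The form in which the contraction factor is used: log y / x steps suffice to
    divide by y. *)
Lemma one_sub_pow_small (x y : R) (j : nat) :
  0 < y -> 0 <= 1 - x -> ln y <= j%:R * x -> (1 - x) ^+ j <= y^-1.
Proof.
move=> y0 x1 yx; apply: le_trans (pow_one_sub_le_exp j x1) _.
by rewrite expRN lef_pV2 ?posrE ?expR_gt0 // -[leLHS]lnK ?posrE // ler_expR.
Qed.

Lemma exists_nat_above (y : R) : 0 <= y -> exists j : nat, y < j%:R <= y + 1.
Proof.
move=> y0; exists (Num.truncn y).+1.
by rewrite truncnS_gt -natr1 lerD2r truncn_le.
Qed.

Lemma exists_nat_below (y : R) : 0 <= y -> exists j : nat, y - 1 <= j%:R <= y.
Proof.
move=> y0; exists (Num.truncn y).
by rewrite lerBlDr natr1 truncn_le y0 andbT ltW // truncnS_gt.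
Qed.

(** With x = log K, the domination number is at most a x + a + 1 after j1 = a x
    greedy steps, and the number of clusters is at most 2 a + 1 after j2 = a log x
    merging steps. *)
Lemma gap_le (T : finType) (e : rel T) (k : nat) :
    (0 < #|T|)%N -> simple_graph e -> connected_graph e -> min_degree_geq e k ->
    0 < ln (ln k.+1%:R : R) ->
  (connected_domination_number e - domination_number e)%:R <=
    #|T|%:R / k.+1%:R * ln (ln k.+1%:R) + 4 * (#|T|%:R / k.+1%:R) + 1 :> R.
Proof.
move=> T0 sg con deg b0.
have a1 : 1 <= #|T|%:R / k.+1%:R :> R by exact: ratio_ge1 sg deg T0.
set a : R := #|T|%:R / k.+1%:R in a1 *; set x : R := ln k.+1%:R in b0 *.
have a0 : 0 < a by lra.
have q0 : 0 <= 1 - a^-1 by rewrite subr_ge0 invf_le1.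
have x1 : 1 <= x.
  by rewrite leNgt; apply/negP => /ltW/ln_le0; rewrite leNgt b0.
have ax0 : 0 <= a * x by rewrite mulr_ge0; lra.
have ab0 : 0 <= a * ln x by rewrite mulr_ge0 // ltW.
have [j1 /andP[/ltW j1ge j1le]] := exists_nat_above ax0.
have [j2 /andP[/ltW j2ge j2le]] := exists_nat_above ab0.
have g1 : (domination_number e)%:R <= a * x + 1 + a.
  have := @domination_number_greedy R _ e k sg deg T0 j1; rewrite -/a => g1.
  have : (1 - a^-1) ^+ j1 <= k.+1%:R^-1.
    apply: one_sub_pow_small; rewrite ?ltr0n //.
    by rewrite ler_pdivlMr // mulrC.
  move=> /(ler_wpM2r (ler0n R #|T|)); rewrite [_^-1 * _]mulrC -/a; lra.
have [p []] := @connected_domination_greedy R _ e k sg deg T0 j2 con.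
rewrite -/a => pa cle.
have pow2 : (1 - a^-1) ^+ j2 <= x^-1.
  apply: one_sub_pow_small; [lra|by []|].
  by rewrite ler_pdivlMr // mulrC.
have p2 : p%:R <= 2 * a + 1.
  have pow0 : 0 <= (1 - a^-1) ^+ j2 by rewrite exprn_ge0.
  have h1 : (1 - a^-1) ^+ j2 * ((domination_number e)%:R - a) <=
            (1 - a^-1) ^+ j2 * (a * x + 1) by rewrite ler_wpM2l //; lra.
  have h2 : (1 - a^-1) ^+ j2 * (a * x + 1) <= x^-1 * (a * x + 1).
    by rewrite ler_wpM2r //; lra.
  have h3 : x^-1 * (a * x + 1) = a + x^-1 by field; lra.
  have h4 : x^-1 <= 1 by rewrite invf_le1 //; lra.
  lra.
have p4 : (2 * p.-1)%:R <= 4 * a.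
  case: p p2 {pa cle} => [|p]; first by rewrite muln0 => _; lra.
  by rewrite -natr1 natrM /=; lra.
have : (connected_domination_number e - domination_number e)%:R <= (j2 + 2 * p.-1)%:R :> R.
  by rewrite ler_nat leq_subLR addnA.
rewrite natrD; lra.
Qed.

Lemma M_upper (n k : nat) : (0 < n)%N -> 0 < ln (ln k.+1%:R : R) ->
  (M n k)%:R <= n%:R / k.+1%:R * ln (ln k.+1%:R) + 4 * (n%:R / k.+1%:R) + 1 :> R.
Proof.
move=> n0 b0; rewrite /M.
apply: (big_ind (fun g : nat => g%:R <= _ :> R)).
- have a0 : 0 <= n%:R / k.+1%:R :> R by rewrite divr_ge0 ?ler0n.
  by rewrite !addr_ge0 ?ler01 // mulr_ge0 ?ler0n // ltW.
- by move=> x y; case: (leqP x y).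
- by move=> E /and3P[sg con deg]; have := gap_le _ sg con deg b0; rewrite card_ord; apply.
Qed.

End Estimates.

(** * Lower bound on the gap *)

Lemma bin_le_exp2 (q m : nat) : ('C(q, m) <= 2 ^ q)%N.
Proof.
rewrite -[X in 'C(X, _)](card_ord q) -card_draws.
by apply: leq_trans (max_card _) _; rewrite -cardsT -powersetT card_powerset cardsT card_ord.
Qed.

(** The probability that a random m-set avoids t given points is the product of
    the factors 1 - m / r with r > Q - t >= m (l + 1), for Q = m (l + 2); each of
    them is at least l / (l + 1). *)
Lemma bin_ratio (l m t : nat) : (t <= m)%N ->
  ('C(m * l.+2, m) * l ^ t <= 'C(m * l.+2 - t, m) * l.+1 ^ t)%N.
Proof.
elim: t => [|t IH] tm; first by rewrite subn0.
have {}IH := IH (ltnW tm).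
rewrite !expnS; set r := (m * l.+2 - t)%N in IH.
have -> : (m * l.+2 - t.+1)%N = r.-1 by rewrite subnS.
have r_ge : (m * l.+1 < r)%N by rewrite /r; nia.
have down := mul_bin_down r m.
have r_gt0 : (0 < r)%N by apply: leq_ltn_trans r_ge.
have step : ('C(r, m) * l <= 'C(r.-1, m) * l.+1)%N.
  rewrite -(leq_pmul2l r_gt0) !mulnA down -mulnA [leqRHS]mulnAC [leqRHS]mulnC mulnCA.
  by rewrite leq_mul2l; apply/orP; right; nia.
apply: (@leq_trans ('C(r, m) * l.+1 ^ t * l)).
  by rewrite mulnCA mulnC leq_mul2r IH orbT.
by rewrite mulnAC [leqRHS]mulnA leq_mul2r step orbT.
Qed.

Section LowerEstimates.
Variable R : realType.

Lemma bin_ratio_exp (l m t : nat) : (0 < l)%N -> (t <= m)%N ->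
  expR (- (t%:R / l%:R)) <= 'C(m * l.+2 - t, m)%:R / 'C(m * l.+2, m)%:R :> R.
Proof.
move=> l0 tm; have := bin_ratio l tm.
rewrite -(ler_nat R) !natrM !natrX => ratio.
have C0 : 0 < 'C(m * l.+2, m)%:R :> R by rewrite ltr0n bin_gt0 leq_pmulr.
have l0' : 0 < l%:R :> R by rewrite ltr0n.
have p0 : 0 < (l.+1%:R : R) ^+ t by rewrite exprn_gt0 // ltr0n.
apply: (@le_trans _ _ (l%:R ^+ t / l.+1%:R ^+ t)); last first.
  by rewrite ler_pdivlMr // mulrAC ler_pdivrMr // mulrC.
rewrite -expr_div_n -[t%:R / _]mulrC -mulNr expRM_natr.
apply: lerXn2r; rewrite ?nnegrE ?expR_ge0 ?divr_ge0 ?ler0n //.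
rewrite expRN -[leRHS]invrK lef_pV2 ?posrE ?expR_gt0 ?invr_gt0 ?divr_gt0 ?ltr0n //.
apply: le_trans (expR_ge1Dx _); rewrite invf_div -natr1 mulrDl divff ?gt_eqF // mul1r.
by [].
Qed.

(** The number of greedy steps needed is log (Q ^ t) divided by the probability of
    avoidance, which is at least exp (- t / l). *)
Lemma unhittable_small (l m t s : nat) : (0 < l)%N -> (0 < m)%N -> (t <= m)%N ->
    t%:R * ln (m * l.+2)%:R * expR (t%:R / l%:R) < s%:R :> R ->
  (1 - 'C(m * l.+2 - t, m)%:R / 'C(m * l.+2, m)%:R) ^+ s * ((m * l.+2) ^ t)%:R < 1 :> R.
Proof.
move=> l0 m0 tm hs; set beta : R := _ / _.
have beta_ge : expR (- (t%:R / l%:R)) <= beta by apply: bin_ratio_exp.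
have Q0 : 0 < (m * l.+2)%:R :> R by rewrite ltr0n muln_gt0 m0.
have beta1 : 0 <= 1 - beta.
  rewrite subr_ge0 ler_pdivrMr ?mul1r ?ler_nat ?leq_bin2l ?leq_subr //.
  by rewrite ltr0n bin_gt0 leq_pmulr.
rewrite natrX -[X in _ * X ^+ _]lnK ?posrE // -expRM_natl.
apply: (@le_lt_trans _ _ (expR (- (s%:R * beta)) * expR (t%:R * ln (m * l.+2)%:R))).
  by rewrite ler_wpM2r ?expR_ge0 // pow_one_sub_le_exp.
rewrite -expRD -[ltRHS]expR0 ltr_expR addrC subr_lt0.
apply: lt_le_trans _ (ler_wpM2l (ler0n _ _) beta_ge).
by rewrite expRN ltr_pdivlMr ?expR_gt0.
Qed.

Lemma square_le_exp (c d : R) : 0 <= c -> 0 < d ->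
  exists Z, 1 <= Z /\ forall z, Z <= z -> c * z ^+ 2 <= expR (z / d).
Proof.
move=> c0 d0; pose Z := Num.max 1 (6 * d ^+ 3 * c); exists Z.
split=> [|z]; first by rewrite le_max lexx.
rewrite ge_max => /andP[z1 zc].
have z0 : 0 <= z / d by rewrite divr_ge0 //; lra.
apply: le_trans (_ : 1 + (z / d) ^+ 3 / 6 <= _); last exact: (expR_ge1Dxn 2 z0).
have d3 : 0 < d ^+ 3 by rewrite exprn_gt0.
have -> : (z / d) ^+ 3 / 6 = z * z ^+ 2 / (6 * d ^+ 3) by field; lra.
apply: ler_wpDl => //; rewrite ler_pdivlMr; last by lra.
have : 0 <= z ^+ 2 by rewrite sqr_ge0.
move=> /(ler_wpM2r)/(_ _ _ zc); lra.
Qed.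

(** Up to rounding, t is (l - 1) log m, so that exp (t / l) is
    m ^ (1 - 1 / l) and the required number s of sets is m ^ (1 - 1 / l) times a
    quadratic polynomial in log m.  This is below m for large m. *)
Lemma hitting_parameters (l : nat) : (0 < l)%N ->
  exists2 Z : R, 1 <= Z & forall m : nat, Z <= ln m%:R ->
    exists t s : nat,
      [/\ (s + t + m <= m * l.+2)%N, (s <= m)%N, l.-1%:R * ln m%:R - 1 <= t%:R :> R &
       (1 - 'C(m * l.+2 - t, m)%:R / 'C(m * l.+2, m)%:R) ^+ s
         * ((m * l.+2) ^ t)%:R < 1 :> R].
Proof.
move=> l0; have l0' : 0 < l%:R :> R by rewrite ltr0n.
pose lam : R := ln l.+2%:R.
have lam0 : 0 <= lam by rewrite ln_ge0 // ler1n.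
pose p : R := l.-1%:R; have p0 : 0 <= p by rewrite ler0n.
have pl : p = l%:R - 1 by rewrite /p -[in RHS](prednK l0) -natr1 addrK.
pose c : R := p * (1 + lam) + 1.
have c0 : 0 <= c by rewrite addr_ge0 // mulr_ge0 //; lra.
have [Z [Z1 Zc]] := square_le_exp c0 l0'.
exists Z => // m; set z : R := ln m%:R => Zm; have := Zc z Zm; set E := expR _ => cE.
have m0 : (0 < m)%N.
  by rewrite lt0n; apply/eqP => m_eq; move: Zm; rewrite /z m_eq ln0 //; lra.
have m0' : 0 < m%:R :> R by rewrite ltr0n.
have z1 : 1 <= z by apply: le_trans Zm.
have mexp : m%:R = expR z :> R by rewrite lnK ?posrE.
have E0 : 0 < E by apply: expR_gt0.
have Em : E <= m%:R.
  rewrite mexp ler_expR ler_pdivrMr // ler_peMr ?ler1n //; lra.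
have zz : z <= z ^+ 2 by rewrite expr2 ler_peMr //; lra.
have pz0 : 0 <= p * z by rewrite mulr_ge0 //; lra.
have [t /andP[t_ge t_le]] := exists_nat_below pz0.
have lnQ : ln (m * l.+2)%:R = z + lam by rewrite natrM lnM ?posrE // ltr0n.
have A_le : p * z * (z + lam) + 1 <= E.
  apply: le_trans cE.
  have h1 : z + lam <= z * (1 + lam).
    by have := mulr_ge0 lam0 (_ : 0 <= z - 1); rewrite subr_ge0 => /(_ z1); lra.
  have := ler_wpM2l pz0 h1; rewrite /c expr2 in zz *; lra.
have tm : (t <= m)%N.
  rewrite -(ler_nat R); apply: le_trans t_le (le_trans _ Em); apply: le_trans A_le.
  have hz : 0 <= z - 1 + lam by lra.
  by have := mulr_ge0 pz0 hz; lra.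
pose y : R := t%:R * ln (m * l.+2)%:R * expR (t%:R / l%:R).
have y_le : y <= p * z * (z + lam) * (m%:R / E).
  rewrite /y lnQ; have e_le : expR (t%:R / l%:R) <= m%:R / E.
    rewrite mexp /E -expRN -expRD ler_expR ler_pdivrMr // mulrBl divfK ?gt_eqF //.
    by rewrite (le_trans t_le) // pl; lra.
  apply: ler_pM => //; rewrite ?expR_ge0 ?mulr_ge0 ?ler0n //; try lra.
  by rewrite ler_wpM2r //; lra.
have y0 : 0 <= y by rewrite !mulr_ge0 ?ler0n ?expR_ge0 // lnQ; lra.
have [s /andP[ys sy]] := exists_nat_above y0.
have sm : (s <= m)%N.
  rewrite -(ler_nat R) (le_trans sy) // (le_trans (lerD y_le (lexx 1))) //.
  rewrite mulrA -lerBrDr ler_pdivrMr //.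
  by have := ler_wpM2r (ltW m0') A_le; lra.
exists t, s; split=> //; last exact: unhittable_small.
have : (m * 3 <= m * l.+2)%N by rewrite leq_mul2l !ltnS l0 orbT.
by move: sm tm; clear; lia.
Qed.

(** The blocks take about (l + 2) k vertices; the guards at most 4 ^ Q, which is
    at most K / 3 since 4 Q <= log K. *)
Lemma gadget_size (l m s k : nat) : (s <= m)%N -> (0 < m)%N ->
    4 <= ln k.+1%:R :> R -> 4 * (m * l.+2)%:R <= ln k.+1%:R :> R ->
  (m * l.+2 * (k %/ m).+1 + (s + s * 'C(m * l.+2, m)) <= l.+3 * k.+1)%N.
Proof.
move=> sm m0 x4 Qx; set Q := (m * l.+2)%N in Qx *.
have powQ : (3 * 4 ^ Q <= k.+1)%N.
  rewrite -(ler_nat R) natrM natrX.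
  have K0 : 0 < k.+1%:R :> R by rewrite ltr0n.
  rewrite -[leRHS]lnK ?posrE //; set x : R := ln _ in x4 Qx *.
  have -> : x = x / 2 + x / 2 by lra.
  rewrite expRD; apply: ler_pM; rewrite ?ler0n ?exprn_ge0 ?ler0n //.
    by apply: le_trans (expR_ge1Dx _); lra.
  have e2 : 2 <= expR 1 :> R by apply: le_trans (expR_ge1Dx _); lra.
  have e4 : 4 <= expR 2 :> R.
    have -> : 2 = 1 + 1 :> R by lra.
    rewrite expRD; apply: le_trans (ler_pM _ _ e2 e2); lra.
  apply: le_trans (_ : expR 2 ^+ Q <= _).
    by apply: lerXn2r; rewrite ?nnegrE ?expR_ge0.
  by rewrite -expRM_natl ler_expR; lra.
have Q2 : (Q <= 2 ^ Q)%N by apply/ltnW/ltn_expl.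
have C2 := bin_le_exp2 Q m.
have four : (4 ^ Q = 2 ^ Q * 2 ^ Q)%N by rewrite -expnMn.
have sQ : (s <= Q)%N by apply: leq_trans sm _; rewrite leq_pmulr.
have e1 : (0 < 2 ^ Q)%N by rewrite expn_gt0.
have mk : (m * (k %/ m) <= k)%N by rewrite mulnC leq_trunc_div.
have h1 : (Q * (k %/ m).+1 <= l.+2 * k + Q)%N.
  by rewrite mulnSr leq_add2r /Q mulnAC mulnC leq_mul2l mk orbT.
have h2 : (s * 'C(Q, m) <= 4 ^ Q)%N by rewrite four leq_mul // (leq_trans sQ).
have h3 : (Q <= 4 ^ Q)%N by rewrite four; apply: leq_trans Q2 _; rewrite leq_pmulr.
have h4 : (l.+3 * k.+1 = l.+2 * k + l.+2 + k.+1)%N by rewrite mulSn mulnSr addnC.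
rewrite h4; move: h1 h2 h3 sQ powQ; clear.
move: (Q * _)%N (s * _)%N (4 ^ Q)%N (l.+2 * k)%N => u v w r; lia.
Qed.

(** Here l + 2 is the ratio L of the order of a gadget to K, up to a lower order
    term for which l + 3 leaves room, and m is about log K / (4 (l + 2)). *)
Lemma M_lower_log (l : nat) : (0 < l)%N ->
  exists B : R, forall n k : nat,
    B <= ln (ln k.+1%:R) -> l.+3%:R <= n%:R / k.+1%:R :> R ->
    (n%:R / k.+1%:R / l.+3%:R - 1)
      * (l.-1%:R * (ln (ln k.+1%:R) - ln (8 * l.+2%:R)) - 1) <= (M n k)%:R :> R.
Proof.
move=> l0; have [Z Z1 hZ] := hitting_parameters l0.
pose C : R := ln (8 * l.+2%:R); exists (Z + C) => n k; set x : R := ln k.+1%:R => Bx an.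
have L2 : 2 <= l.+2%:R :> R by rewrite ler_nat.
have C0 : 0 <= C by rewrite ln_ge0 //; lra.
have x0 : 0 < x.
  by rewrite ltNge; apply/negP => /ln0; lra.
have xC : 8 * l.+2%:R <= x.
  by rewrite -ler_ln ?posrE //; rewrite -?/C; lra.
have xL0 : 0 <= x / (4 * l.+2%:R) by rewrite divr_ge0 //; lra.
have [m /andP[m_ge m_le]] := exists_nat_below xL0.
have L4 : 0 < 4 * l.+2%:R :> R by lra.
rewrite ler_pdivlMr // in m_le; rewrite lerBlDr ler_pdivrMr // in m_ge.
have m_big : x / (8 * l.+2%:R) <= m%:R by rewrite ler_pdivrMr; lra.
have m0 : 0 < m%:R :> R.
  by apply: lt_le_trans m_big; rewrite divr_gt0 //; lra.
have zb : ln x - C <= ln m%:R :> R.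
  have L8 : 0 < 8 * l.+2%:R :> R by lra.
  by rewrite /C -ln_div ?posrE // ler_ln ?posrE // divr_gt0.
have Zm : Z <= ln m%:R :> R by lra.
have [t [s [stm sm t_ge small]]] := hZ m Zm.
have m0' : (0 < m)%N by rewrite -(ltr0n R).
have size : (m * l.+2 * (k %/ m).+1 + (s + s * 'C(m * l.+2, m)) <= l.+3 * k.+1)%N.
  by apply: gadget_size => //; [rewrite -/x; lra | rewrite natrM -/x; lra].
move: size; set n0 := (_ + _)%N => size.
have K0 : 0 < k.+1%:R :> R by rewrite ltr0n.
have n_ge : (l.+3 * k.+1 <= n)%N by rewrite -(ler_nat R) natrM -ler_pdivlMr.
have n0_gt0 : (0 < n0)%N by rewrite addn_gt0 !muln_gt0 m0'.
have N_gt0 : (0 < n %/ n0)%N by rewrite divn_gt0 // (leq_trans size).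
have kc : (k <= m * (k %/ m).+1)%N by rewrite mulnC ltnW // ltn_ceil.
have Nn : (n %/ n0 * n0 <= n)%N by apply: leq_trunc_div.
have := M_lower m0' stm (ltn0Sn _) kc N_gt0 Nn small.
rewrite -(ler_nat R) natrM; apply: le_trans.
have N_ge : n%:R / k.+1%:R / l.+3%:R - 1 <= (n %/ n0)%:R :> R.
  rewrite lerBlDr natr1 -mulrA -invfM -natrM ler_pdivrMr ?ltr0n ?muln_gt0 //.
  rewrite -natrM ler_nat (leq_trans (ltnW (ltn_ceil n n0_gt0))) // leq_mul2l.
  by rewrite [(k.+1 * _)%N]mulnC size orbT.
have a1 : 0 <= n%:R / k.+1%:R / l.+3%:R - 1 :> R.
  by rewrite subr_ge0 ler_pdivlMr ?ltr0n // mul1r.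
apply: (@le_trans _ _ ((n%:R / k.+1%:R / l.+3%:R - 1) * t%:R)); last first.
  by rewrite ler_wpM2r ?ler0n.
apply: ler_wpM2l => //; apply: le_trans t_ge; rewrite lerD2r ler_wpM2l ?ler0n //.
Qed.

End LowerEstimates.

(** * Asymptotics *)

Section Asymptotics.
Variable R : realType.

(** The factor (q - 4) / q is at least 1 - eps / 2 for q >= 8 / eps; the
    additive constants are absorbed by the other half of eps. *)
Lemma M_lower_ratio (eps : R) : 0 < eps ->
  exists B : R, forall n k : nat,
    B <= ln (ln k.+1%:R) -> B <= n%:R / k.+1%:R :> R ->
    (1 - eps) * (n%:R / k.+1%:R * ln (ln k.+1%:R)) <= (M n k)%:R :> R.
Proof.
move=> eps0.
have [l l_gt0 l_big] : exists2 l : nat, (0 < l)%N & 8 / eps <= l.+3%:R.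
  exists (Num.truncn (8 / eps)).+1 => //; apply: ltW.
  by apply: lt_trans (truncnS_gt _) _; rewrite ltr_nat !ltnS leqW // leqW.
have [B hB] := M_lower_log R l_gt0.
have lp : l.-1%:R = l.+3%:R - 4 :> R
  by case: l l_gt0 {l_big hB} => // p _; rewrite /= -[p.+4]addn4 natrD addrK.
have q4 : 4 <= l.+3%:R :> R by rewrite ler_nat.
set C : R := ln (8 * l.+2%:R) in hB; set q : R := l.+3%:R in hB lp q4 l_big.
rewrite ler_pdivrMr // in l_big.
pose w : R := (q - 4) * C + 1.
have C0 : 0 <= C.
  rewrite ln_ge0 //; have : 2 <= l.+2%:R :> R by rewrite ler_nat.
  lra.
have w0 : 0 <= w by rewrite addr_ge0 // mulr_ge0 //; lra.
exists (Num.max B (Num.max q (Num.max (4 * w / eps) (4 * q / eps)))) => n k.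
rewrite !ge_max => /and4P[Bb _ wb qb] /and4P[_ qa _ qa'].
apply: le_trans (hB n k Bb qa).
set a : R := n%:R / _ in qa qa' *; set b : R := ln (ln _) in Bb wb qb *.
rewrite !ler_pdivrMr // in wb qb qa'; rewrite lp.
have eb : 0 < b by rewrite -(pmulr_lgt0 _ eps0); lra.
have -> : (a / q - 1) * ((q - 4) * (b - C) - 1) = (a - q) * ((q - 4) * b - w) / q.
  by rewrite /w; field; lra.
rewrite ler_pdivlMr; last by lra.
have h1 : 0 <= a * q * (b * eps - 4 * w) by rewrite !mulr_ge0 //; lra.
have h2 : 0 <= q * b * (a * eps - 4 * q) by rewrite !mulr_ge0 //; lra.
have h3 : 0 <= a * b * (q * eps - 8) by rewrite !mulr_ge0 //; lra.
have h4 : 0 <= a * w * (q - 1) by rewrite !mulr_ge0 //; lra.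
have h5 : 0 <= q * b by rewrite !mulr_ge0 //; lra.
have h6 : 0 <= q * w by rewrite !mulr_ge0 //; lra.
lra.
Qed.

Lemma M_upper_ratio (eps : R) : 0 < eps ->
  exists B : R, forall n k : nat,
    B <= ln (ln k.+1%:R) -> B <= n%:R / k.+1%:R :> R ->
    (M n k)%:R <= (1 + eps) * (n%:R / k.+1%:R * ln (ln k.+1%:R)) :> R.
Proof.
move=> eps0; exists (Num.max 1 (8 / eps)) => n k.
rewrite !ge_max => /andP[b1 eb] /andP[a1 _].
have n0 : (0 < n)%N.
  by rewrite lt0n; apply/eqP => n0; move: a1; rewrite n0 mul0r; lra.
apply: le_trans (M_upper n0 _) _; first by lra.
set a : R := n%:R / _ in a1 *; set b : R := ln (ln _) in b1 eb *.
rewrite ler_pdivrMr // in eb.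
have : 0 <= a * (b * eps - 8) by rewrite mulr_ge0; lra.
lra.
Qed.

End Asymptotics.

Local Open Scope classical_set_scope.

Theorem corollary1p6 (R : realType) (n k : nat -> nat)
  (hnk : forall i : nat, (1 < k i <= n i - 1)%N)
  (hk : (k i)%:R @[i --> \oo] --> (+oo : set_system R))
  (hn : (n i)%:R / (k i + 1)%:R @[i --> \oo] --> (+oo : set_system R)) :
  (M (n i) (k i))%:R
    / ((n i)%:R / (k i + 1)%:R * ln (ln (k i + 1)%:R)) @[i --> \oo]
  --> (1 : R).
Proof.
apply/cvgrPdist_le => eps eps0.
have [B1 lower] := M_lower_ratio eps0; have [B2 upper] := M_upper_ratio eps0.
pose B : R := Num.max 1 (Num.max B1 B2).
have ka : \forall i \near \oo, expR (expR B) <= (k i)%:R by apply: cvgry_ge.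
have na : \forall i \near \oo, B <= (n i)%:R / (k i + 1)%:R by apply: cvgry_ge.
near=> i.
have ki : expR (expR B) <= (k i)%:R by near: i.
have ni : B <= (n i)%:R / (k i + 1)%:R by near: i.
rewrite addn1 in ni *; have bi : B <= ln (ln (k i).+1%:R).
  have e1 : expR (expR B) <= (k i).+1%:R by apply: le_trans ki _; rewrite ler_nat.
  have e2 : expR B <= ln (k i).+1%:R.
    by rewrite -[leLHS]expRK ler_ln ?posrE ?expR_gt0 // ltr0n.
  by rewrite -[leLHS]expRK ler_ln ?posrE ?expR_gt0 // (lt_le_trans _ e2) ?expR_gt0.
move: (bi) (ni); rewrite !ge_max => /and3P[b1 bB1 bB2] /and3P[a1 aB1 aB2].
have lo := lower _ _ bB1 aB1; have up := upper _ _ bB2 aB2.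
set ab : R := _ * ln _ in lo up *.
have ab0 : 0 < ab by rewrite mulr_gt0 // (lt_le_trans ltr01).
rewrite ler_distlC ler_pdivlMr // ler_pdivrMr //.
by rewrite lo up.
Unshelve. all: by end_near.
Qed.
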